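(* Assume the RRK (relaxation Runge-Kutta) method takes $K$ steps, the last step being taken as an IDT step with step size $\Delta t^*=T-t_{K-1}$; let $\overline y$ be the vector of all computed step values and internal stages and $\widetilde E$ the associated reduced state-equation operator (see context). For any $\overline{w}=(w_0,W_1,w_1,\dots,W_K,w_K)\in\mathbb R^{\overline N}$, the linearized RRK system $\widetilde E'(\overline y)\,\overline\delta=\overline w$ for $\overline\delta=(\delta_0,\Delta_1,\delta_1,\dots,\Delta_K,\delta_K)$ is given by the following time-stepping formulas (forward substitution): $\delta_0=w_0$; for $k=1,\dots,K-1$, $$\Delta_{k,i}=\delta_{k-1}+\Delta t\sum_{j=1}^s a_{ij}J_{k,j}\Delta_{k,j}+W_{k,i},\qquad i=1,\dots,s,$$ $$\delta_k=\delta_{k-1}+\gamma_k\Delta t\sum_{i=1}^s b_iJ_{k,i}\Delta_{k,i}+\rho_k\Delta t\sum_{i=1}^s b_iF_{k,i}+w_k;$$ and for the final step $$\Delta_{K,i}=\delta_{K-1}+\Delta t^*\sum_{j=1}^s a_{ij}J_{K,j}\Delta_{K,j}-\rho_*\,\Delta t\sum_{j=1}^s a_{ij}F_{K,j}+W_{K,i},\qquad i=1,\dots,s,$$ $$\delta_K=\delta_{K-1}+\gamma_K\Delta t^*\sum_{i=1}^s b_iJ_{K,i}\Delta_{K,i}+\rho_K\Delta t^*\sum_{i=1}^s b_iF_{K,i}+w_K,$$ where $\rho_k=(\nabla_y\gamma_k)^\top\delta_{k-1}+(\nabla_Y\gamma_k)^\top\Delta_k$ for $k=1,\dots,K$ and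 $\rho_*=\sum_{k=1}^{K-1}\rho_k$.
   Context: Consider the initial value problem $y'(t)=f(y(t),t)$, $t_0=0<t\le T$, $y(0)=y_{\rm init}\in\mathbb R^N$, with $f$ differentiable in $y$ and a smooth convex entropy function $\eta:\mathbb R^N\to\mathbb R$. Fix an $s$-stage Runge-Kutta method with coefficients $a_{ij},b_i,c_i$ ($1\le i,j\le s$) and step size $\Delta t>0$. Vectors of length $\overline N=N+N(s+1)K$ are written in blocks as $\overline y=(y_0,Y_1,y_1,\dots,Y_K,y_K)$ with $y_k\in\mathbb R^N$, $Y_k=(Y_{k,1},\dots,Y_{k,s})\in\mathbb R^{sN}$; the same convention is used for $\overline w=(w_0,W_1,w_1,\dots)$ and $\overline\delta=(\delta_0,\Delta_1,\delta_1,\dots)$ (the block $\Delta_k=(\Delta_{k,1},\dots,\Delta_{k,s})$ should not be confused with the step sizes $\Delta t,\Delta t^*$). RRK method with $K$ steps ($K$ fixed): let $h_k=\Delta t$ for $k=1,\dots,K-1$ and $h_K=\Delta t^*$. Set $y_0=y_{\rm init}$ and, for $k=1,\dots,K$, $$Y_{k,i}=y_{k-1}+h_k\sum_ja_{ij}F_{k,j},\qquad y_k=y_{k-1}+\gamma_kh_k\sum_ib_iF_{k,i},$$ where $F_{k,i}=f(Y_{k,i},t_{k-1}+c_ih_k)$, $J_{k,i}=\frac{\partial f}{\partial y}(Y_{k,i},t_{k-1}+c_ih_k)$, $t_k=t_{k-1}+\gamma_k\Delta t$ for $k\le K-1$, $t_K=T$, and $$\Delta t^*=T-t_{K-1}=T-t_0-\Delta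 t\sum_{\ell=1}^{K-1}\gamma_\ell>0.$$ The relaxation parameter $\gamma_k$ is the non-zero root closest to $1$ of $$r_k(\gamma)=\eta\Big(y_{k-1}+\gamma h_k\sum_{i}b_iF_{k,i}\Big)-\eta(y_{k-1})-\gamma h_k\sum_{i}b_i\nabla\eta(Y_{k,i})^\top F_{k,i};$$ it is assumed that this root exists and $\partial r_k/\partial\gamma\neq0$ there. For $k\le K-1$ this implicitly defines $\gamma_k$ as a differentiable function of $(y_{k-1},Y_k)$; $\Delta t^*$ is then a function of $(y_{\ell-1},Y_\ell)$, $\ell=1,\dots,K-1$, through $\gamma_1,\dots,\gamma_{K-1}$; and $\gamma_K$ is a function of $(y_{K-1},Y_K)$ and of $\Delta t^*$, hence of all $(y_{\ell-1},Y_\ell)$, $\ell=1,\dots,K$. All blocks of $\overline y$ are regarded as independent variables in these dependencies. In differentiation, $F_{k,i}$ is viewed as a function of $Y_{k,i}$ only (the times $t_{k-1}+c_ih_k$ at which $f$ is evaluated are held fixed). For all $k=1,\dots,K$, $$(\nabla_y\gamma_k)^\top=-\Big(\frac{\partial r_k}{\partial\gamma}\Big)^{-1}\frac{\partial r_k}{\partial y_{k-1}},\qquad(\nabla_Y\gamma_{k,i})^\top=-\Big(\frac{\partial r_k}{\partial\gamma}\Big)^{-1}\frac{\partial r_k}{\partial Y_{k,i}},\qquad\nabla_Y\gamma_k=(\nabla_Y\gamma_{k,1},\dots,\nabla_Y\gamma_{k,s}),$$ evaluated at $\gamma=\gamma_k$ (partial derivatives of $\gamma_k$ with respect to $y_{k-1}$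 and $Y_{k,i}$; for $k=K$ with step size $h_K=\Delta t^*$ in $r_K$). The reduced state-equation operator $\widetilde E$ (defined near $\overline y$ in $\mathbb R^{\overline N}$) has blocks, in the same ordering: initial block $y_0-y_{\rm init}$; and for each $k=1,\dots,K$ the stage blocks $Y_{k,i}-y_{k-1}-h_k\sum_ja_{ij}F_{k,j}$ ($i=1,\dots,s$) followed by the step block $y_k-y_{k-1}-\gamma_kh_k\sum_ib_iF_{k,i}$, with $\gamma_k=\gamma_k(\overline y)$ and $h_K=\Delta t^*(\overline y)$. $\widetilde E'(\overline y)$ denotes its total Jacobian matrix, including the dependence of all $\gamma_k$ and of $\Delta t^*$ on $\overline y$. *)

(* Defs.v *)
From HB Require Import structures.
From mathcomp Require Export all_boot all_order all_algebra.
From mathcomp Require Export all_classical all_reals all_analysis.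
Export Order.TTheory GRing.Theory Num.Theory.
Export numFieldNormedType.Exports.

Set Implicit Arguments.
Unset Strict Implicit.
Unset Printing Implicit Defensive.

Local Open Scope classical_set_scope.
Local Open Scope ring_scope.

(* Vectors of R^N are rows, so a Jacobian matrix J acts on the right: what is
   written J v for column vectors is v *m J here, the convention of 'J. *)

Section Calculus.
Context {R : realType}.

Definition dotmx m n (A B : 'M[R]_(m, n)) : R := \sum_i \sum_j A i j * B i j.

Definition grad m n (g : 'M[R]_(m, n) -> R) (X : 'M[R]_(m, n)) : 'M[R]_(m, n) :=
  \matrix_(i, j) 'D_(delta_mx i j) g X.

Fixpoint Cn N (k : nat) (g : 'rV[R]_N -> R) : Prop :=
  if k is k'.+1 then
    (forall x, differentiable g x) /\
    (forall j, Cn k' (fun x => 'D_(delta_mx 0 j) g x))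
  else continuous g.

Definition smooth N (g : 'rV[R]_N -> R) : Prop := forall k, Cn k g.

End Calculus.

(* The row vector y = (y_0, Y_1, y_1, ..., Y_K, y_K) of R^(N + N(s+1)K).
   Time steps are indexed from 0: the ordinal k : 'I_K stands for step k+1, and
   widen_ord, lift ord0 : 'I_K -> 'I_K.+1 give the indices of its initial and
   final time levels.  The stages Y_k form an s x N matrix with rows Y_(k,i). *)
Section Blocks.
Context {R : realType} {N s K : nat}.

Definition Nbar : nat := (N + K * (s * N + N))%N.

Definition before (k : 'I_K) : 'I_K.+1 := widen_ord (leqnSn K) k.
Definition after (k : 'I_K) : 'I_K.+1 := lift ord0 k.

Definition block (y : 'rV[R]_Nbar) (k : 'I_K) : 'rV[R]_(s * N + N) :=
  row k (vec_mx (rsubmx y)).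

Definition stages (y : 'rV[R]_Nbar) (k : 'I_K) : 'M[R]_(s, N) :=
  vec_mx (lsubmx (block y k)).

Definition level (y : 'rV[R]_Nbar) (k : 'I_K.+1) : 'rV[R]_N :=
  if unlift ord0 k is Some k' then rsubmx (block y k') else lsubmx y.

Definition assemble (y0 : 'rV[R]_N) (Y : 'I_K -> 'M[R]_(s, N))
    (y : 'I_K -> 'rV[R]_N) : 'rV[R]_Nbar :=
  row_mx y0 (mxvec (\matrix_(k < K) row_mx (mxvec (Y k)) (y k))).

End Blocks.
Arguments Nbar : clear implicits.

Section Relaxation.
Context {R : realType} {N s : nat}.
Variables (f : 'rV[R]_N -> R -> 'rV[R]_N) (eta : 'rV[R]_N -> R) (b : 'I_s -> R).

(* tau i is the time at which f is evaluated in stage i; it is a parameter, and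
   not a function of the step size, since it is held fixed in differentiation. *)
Definition stageF (tau : 'I_s -> R) (Y : 'M[R]_(s, N)) (i : 'I_s) : 'rV[R]_N :=
  f (row i Y) (tau i).

Definition stageJ (tau : 'I_s -> R) (Y : 'M[R]_(s, N)) (i : 'I_s) : 'M[R]_N :=
  'J (f ^~ (tau i)) (row i Y).

Definition residual (h : R) (tau : 'I_s -> R) (y : 'rV[R]_N)
    (Y : 'M[R]_(s, N)) (g : R) : R :=
  eta (y + (g * h) *: \sum_i b i *: stageF tau Y i) - eta y
  - g * h * \sum_i b i * dotmx (grad eta (row i Y)) (stageF tau Y i).

Definition closest_root (r : R -> R) (g : R) : Prop :=
  [/\ g != 0, r g = 0
    & forall g', g' != 0 -> r g' = 0 -> `|g - 1| <= `|g' - 1|].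

(* Meaningful only where such a root exists (junk value 0 elsewhere). *)
Definition relax_param (h : R) (tau : 'I_s -> R) (y : 'rV[R]_N)
    (Y : 'M[R]_(s, N)) : R :=
  xget 0 [set g | closest_root (residual h tau y Y) g].

(* Gradients of relax_param with respect to y and Y, at fixed h, as given by
   implicit differentiation of residual h tau y Y g = 0. *)
Definition relax_grad_y (h : R) (tau : 'I_s -> R) (y : 'rV[R]_N)
    (Y : 'M[R]_(s, N)) (g : R) : 'rV[R]_N :=
  - (derive1 (residual h tau y Y) g)^-1 *: grad (fun y' => residual h tau y' Y g) y.

Definition relax_grad_Y (h : R) (tau : 'I_s -> R) (y : 'rV[R]_N)
    (Y : 'M[R]_(s, N)) (g : R) : 'M[R]_(s, N) :=
  - (derive1 (residual h tau y Y) g)^-1 *: grad (fun Y' => residual h tau y Y' g) Y.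

End Relaxation.

Section RRK.
Context {R : realType} {N s K : nat}.
Variables (f : 'rV[R]_N -> R -> 'rV[R]_N) (eta : 'rV[R]_N -> R).
Variables (a : 'M[R]_s) (b c : 'I_s -> R) (dt T : R) (yinit : 'rV[R]_N).

Definition step_size (t : 'I_K.+1 -> R) (k : 'I_K) : R :=
  if k.+1 == K then T - t (before k) else dt.

Definition stage_time (t : 'I_K.+1 -> R) (k : 'I_K) (i : 'I_s) : R :=
  t (before k) + c i * step_size t k.

(* y, t and gamma are the values, time levels and relaxation parameters computed
   by the method in K steps, with dgamma r_k != 0 at each gamma k. *)
Definition rrk_solution (y : 'rV[R]_(Nbar N s K)) (t : 'I_K.+1 -> R)
    (gamma : 'I_K -> R) : Prop :=
  [/\ t ord0 = 0,
      level y ord0 = yinit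
    & forall k : 'I_K,
        let h := step_size t k in
        let tau := stage_time t k in
        let F := stageF f tau (stages y k) in
        let r := residual f eta b h tau (level y (before k)) (stages y k) in
        [/\ t (after k) = (if k.+1 == K then T else t (before k) + gamma k * dt),
            0 < h,
            forall i, row i (stages y k) =
              level y (before k) + h *: \sum_j a i j *: F j,
            level y (after k) =
              level y (before k) + (gamma k * h) *: \sum_i b i *: F i
          & closest_root r (gamma k) /\ derive1 r (gamma k) != 0]].

(* The reduced operator.  All blocks of y are independent variables; the
   evaluation times tau are frozen, whereas the relaxation parameters and the
   last step size are functions of y. *)
Section Reduced.
Variable tau : 'I_K -> 'I_s -> R.

Definition last_step_size (y : 'rV[R]_(Nbar N s K)) : R :=
  T - dt * \sum_(l < K | (l.+1 < K)%N)
    relax_param f eta b dt (tau l) (level y (before l)) (stages y l).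

Definition reduced_step_size (y : 'rV[R]_(Nbar N s K)) (k : 'I_K) : R :=
  if k.+1 == K then last_step_size y else dt.

Definition reduced_gamma (y : 'rV[R]_(Nbar N s K)) (k : 'I_K) : R :=
  relax_param f eta b (reduced_step_size y k) (tau k)
    (level y (before k)) (stages y k).

Definition reduced_op (y : 'rV[R]_(Nbar N s K)) : 'rV[R]_(Nbar N s K) :=
  let F k := stageF f (tau k) (stages y k) in
  let h := reduced_step_size y in
  assemble (level y ord0 - yinit)
    (fun k => \matrix_(i < s) (row i (stages y k) - level y (before k)
                               - h k *: \sum_j a i j *: F k j))
    (fun k => level y (after k) - level y (before k)
              - (reduced_gamma y k * h k) *: \sum_i b i *: F k i).

End Reduced.
End RRK.

(* Main.v *)
Require Import Defs.
From mathcomp Require Import ring lra.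

(** Why the linearized system has this form.

    The only delicate point is that the relaxation parameters, defined as the
    non-zero roots of the residuals closest to 1, are differentiable near the
    computed solution, although f is merely differentiable in y.  The product
    G = gamma h of relaxation parameter and step size is a root of

      psi (y, Y, G) = eta (y + G sum_i b_i F_i) - eta y
                      - G sum_i b_i grad eta (Y_i) . F_i,

    in which h no longer occurs.  As eta is convex, psi is convex in G, and it
    vanishes at G = 0.  A convex function that vanishes at 0 and takes a
    negative value has at most one other zero ([convex_only_root]); it does take
    a negative value as soon as its slope at a non-zero zero does not vanish
    ([slope_neg_value]).  Being negative at a given point is an open condition,
    so near the solution psi still has exactly one non-zero zero, and this zero
    depends continuously on (y, Y) ([convex_root_persists], by the intermediate
    value theorem).  Hence being closest to 1 is no constraint at all, the
    relaxation parameter for the step size h is G (y, Y) / h, and G is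
    differentiable by implicit differentiation ([is_diff_implicit]).  The latter
    requires psi to be differentiable only at the point considered, because the
    continuity of G is already known; this is what makes f differentiable,
    rather than continuously differentiable, sufficient.

    Consequently the factor gamma_k h_k in a step block is G (y_(k-1), Y_k),
    whatever the step size.  Its differential is rho_k h_k, also in the last
    step, where h depends on all earlier blocks: the dependence of gamma_K on
    the last step size exactly compensates the variation of that step size.
    This is why rho_star occurs in the stage equations of the last step, through
    the explicit factor h_K, but not in its step equation.  The remaining work
    is the product rule, carried out block by block ([is_diff_reduced_op]), and
    the identification of the blocks of a vector ([assemble_eqP]). *)

Set Implicit Arguments.
Unset Strict Implicit.
Unset Printing Implicit Defensive.

Local Open Scope classical_set_scope.
Local Open Scope ring_scope.

(** * Differentials of matrix-valued functions *)

Section Differentials.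
Context {R : realType}.

(** The form in which differentiability is verified by explicit estimates; the
    candidate differential has to be known to be linear and continuous. *)
Lemma is_diff_leP (V W : normedModType R) (f : V -> W)
    (df : {linear V -> W}) x :
  is_diff x f df <-> continuous df /\
  forall e, 0 < e ->
    \forall v \near 0, `|f (v + x) - f x - df v| <= e * `|v|.
Proof.
split.
  case=> fx <-; split; first exact: diff_continuous.
  move=> e e0; have /eqaddoP /(_ e e0) := diff_locally fx.
  apply: filterS => v /=.
  by rewrite /cst !fctE /= opprD addrA.
move=> [cdf H].
have E : f \o shift x = cst (f x) + df +o_ 0 id.
  apply/eqaddoP => e e0; apply: filterS (H e e0) => v.
  by rewrite !fctE /= opprD addrA.
have dE := diff_unique cdf E.
apply: DiffDef (dE).
by apply/diff_locallyP; rewrite dE.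
Qed.

Lemma is_diff_ex (V W : normedModType R) (f df : V -> W) x :
  is_diff x f df -> differentiable f x.
Proof. by move=> ?; exact: ex_diff. Qed.

Lemma is_diff_diffE (V W : normedModType R) (f df : V -> W) x :
  is_diff x f df -> forall v, 'd f x v = df v.
Proof. by move=> ? v; rewrite diff_val. Qed.

(** Relaxation parameters are given by a formula only near the solution, so
    differentials have to be transported along local equalities. *)
Lemma is_diff_near (V W : normedModType R) (f g : V -> W) df x :
  is_diff x f df -> (\forall p \near x, f p = g p) -> is_diff x g df.
Proof.
move=> dfx; have -> : df = 'd f x by rewrite diff_val.
move=> fg; have fgx := nbhs_singleton fg.
have /is_diff_leP[cdf H] : is_diff x f ('d f x) by apply/differentiableP.
apply/is_diff_leP; split => // e e0.
near=> v; have <- : f (v + x) = g (v + x).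
  by near: v; move: fg; rewrite (near_shift 0) subr0.
by rewrite -fgx; near: v; exact: H.
Unshelve. all: by end_near. Qed.

Lemma is_diff_sum (V W : normedModType R) (I : Type) (r : seq I) (P : pred I)
    (f df : I -> V -> W) x :
  (forall i, P i -> is_diff x (f i) (df i)) ->
  is_diff x (fun p => \sum_(i <- r | P i) f i p)
            (fun v => \sum_(i <- r | P i) df i v).
Proof.
move=> dfx; rewrite -!fct_sumE.
elim: r => [|i r IH]; first by rewrite !big_nil; exact: is_diff_cst.
rewrite !big_cons; case: ifP => // Pi.
by apply: is_diffD => //; exact: dfx.
Qed.

Lemma is_diff_coord m n (i : 'I_m) (j : 'I_n) (x : 'M[R]_(m, n)) :
  is_diff x (fun A : 'M[R]_(m, n) => A i j : R) (fun A => A i j).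
Proof.
have @f : {linear 'M[R]_(m, n) -> R}.
  by exists (fun A : 'M[R]_(_, _) => A i j); do 2![eexists];
     do ?[constructor]; rewrite ?mxE// => ? *; rewrite ?mxE//; move=> ?;
     rewrite !mxE.
have cf : continuous f by exact: coord_continuous.
have dfx : is_diff x (f : _ -> R) f.
  apply: DiffDef; first exact: linear_differentiable.
  exact: diff_lin.
exact: dfx.
Qed.

(** M is the sum of its entries times the constant matrices [delta_mx i j], so
    differentials of matrix-valued maps can be computed entrywise. *)
Lemma is_diff_mx (V : normedModType R) m n (M dM : V -> 'M[R]_(m, n)) x :
  (forall i j, is_diff x (fun p => M p i j : R) (fun v => dM v i j)) ->
  is_diff x M dM.
Proof.
move=> dMx.
have E (N : V -> 'M[R]_(m, n)) :
    N = fun p => \sum_i \sum_j N p i j *: delta_mx i j.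
  by apply/funext => p; exact: matrix_sum_delta.
rewrite (E M) (E dM); apply: is_diff_sum => i _; apply: is_diff_sum => j _.
have dij := dMx i j.
apply: DiffDef; first exact: differentiableZl.
by rewrite diffZl // diff_val.
Qed.

Lemma is_diff_mxE (V : normedModType R) m n (M dM : V -> 'M[R]_(m, n)) x i j :
  is_diff x M dM -> is_diff x (fun p => M p i j : R) (fun v => dM v i j).
Proof. by move=> dMx; exact: (is_diff_comp dMx (is_diff_coord i j (M x))). Qed.

(** Rows, blocks, time levels and stages of a vector all select entries; such a
    map is linear and continuous, and is its own differential. *)
Lemma is_diff_reindex m n m' n' (M : 'M[R]_(m, n) -> 'M[R]_(m', n')) x :
  (forall i j, exists i' j', forall p, M p i j = p i' j') -> is_diff x M M.
Proof.
move=> H; apply: is_diff_mx => i j; have [i' [j' Hij]] := H i j.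
have -> : (fun p => M p i j) = (fun p => p i' j') by apply/funext.
exact: is_diff_coord.
Qed.

Lemma is_diff_mul (V : normedModType R) (f g df dg : V -> R) x :
  is_diff x f df -> is_diff x g dg ->
  is_diff x (fun p => f p * g p) (fun v => f x * dg v + df v * g x).
Proof.
move=> dfx dgx; apply: is_diff_eq (is_diffM dfx dgx) _.
by apply/funext => v; rewrite !fctE /=; congr (_ + _); exact: mulrC.
Qed.

Lemma is_diff_scale (V : normedModType R) m n (k dk : V -> R)
    (M dM : V -> 'M[R]_(m, n)) x :
  is_diff x k dk -> is_diff x M dM ->
  is_diff x (fun p => k p *: M p) (fun v => k x *: dM v + dk v *: M x).
Proof.
move=> dkx dMx; apply: is_diff_mx => i j.
have E : is_diff x (fun p => k p * M p i j)
  (fun v => k x * dM v i j + dk v * M x i j).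
  by apply: is_diff_mul => //; exact: is_diff_mxE.
apply: is_diff_eq; last first.
  by apply/funext => v; rewrite 3!mxE; reflexivity.
apply: is_diff_near E _; apply: nearW => p; by rewrite mxE.
Qed.

Lemma is_diff_fst (U V : normedModType R) (x : U * V) : is_diff x fst fst.
Proof.
have c : continuous (fst : U * V -> U) by move=> z; exact: cvg_fst.
apply: DiffDef; first exact: linear_differentiable.
exact: diff_lin.
Qed.

Lemma is_diff_snd (U V : normedModType R) (x : U * V) : is_diff x snd snd.
Proof.
have c : continuous (snd : U * V -> V) by move=> z; exact: cvg_snd.
apply: DiffDef; first exact: linear_differentiable.
exact: diff_lin.
Qed.

Lemma diff_dotmx_grad m n (g : 'M[R]_(m, n) -> R) X A :
  differentiable g X -> 'd g X A = dotmx (grad g X) A.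
Proof.
move=> dg; rewrite {1}(matrix_sum_delta A) linear_sum /dotmx.
apply: eq_bigr => i _; rewrite linear_sum; apply: eq_bigr => j _.
by rewrite linearZ /= mxE deriveE // mulrC.
Qed.

Lemma is_diff_row m n (Y : 'M[R]_(m, n)) i :
  is_diff Y (fun Z : 'M[R]_(m, n) => row i Z) (fun Z => row i Z).
Proof.
by apply: is_diff_reindex => i' j; exists i, j => p; rewrite mxE.
Qed.

Lemma is_diff_rows (V : normedModType R) m n
    (r dr : V -> 'I_m -> 'rV[R]_n) x :
  (forall i, is_diff x (r ^~ i) (dr ^~ i)) ->
  is_diff x (fun z => \matrix_(i < m) r z i) (fun v => \matrix_(i < m) dr v i).
Proof.
move=> dr_x; apply: is_diff_mx => i j.
have rowE (g : V -> 'I_m -> 'rV[R]_n) :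
    (fun z => (\matrix_(i < m) g z i) i j) = fun z => g z i 0 j.
  by apply/funext => z; rewrite mxE.
by rewrite !rowE; exact: is_diff_mxE (dr_x i).
Qed.

Lemma dotmxZl m n (k : R) (A B : 'M[R]_(m, n)) :
  dotmx (k *: A) B = k * dotmx A B.
Proof.
rewrite /dotmx mulr_sumr; apply: eq_bigr => i _; rewrite mulr_sumr.
by apply: eq_bigr => j _; rewrite mxE mulrA.
Qed.

Lemma differentiable_dotmx (V : normedModType R) m n
    (A B : V -> 'M[R]_(m, n)) x :
  differentiable A x -> differentiable B x ->
  differentiable (fun p => dotmx (A p) (B p)) x.
Proof.
move=> dA dB; rewrite /dotmx.
suff E : is_diff x (fun p => \sum_i \sum_j A p i j * B p i j)
   (fun v => \sum_i \sum_j (A x i j * 'd B x v i j + 'd A x v i j * B x i j)).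
  exact: is_diff_ex.
apply: is_diff_sum => i _; apply: is_diff_sum => j _.
by apply: is_diff_mul; apply: is_diff_mxE; exact: differentiableP.
Qed.

End Differentials.

(** * Zeros of convex functions of one variable *)

Section ConvexRoots.
Context {R : realType}.
Implicit Types (r : R -> R) (u x G : R).

(** Convexity on the real line, with the weight t a plain real number so that it
    can take part in arithmetic. *)
Definition convex_ineq r : Prop := forall x y t,
  0 <= t -> t <= 1 -> r (t * x + (1 - t) * y) <= t * r x + (1 - t) * r y.

Definition only_root r G : Prop :=
  [/\ G != 0, r G = 0 & forall g, g != 0 -> r g = 0 -> g = G].

(** The zero closer to u would be a proper convex combination of u and of the
    farther zero, and the function would be negative there. *)
Lemma convex_root_side r u x y : convex_ineq r ->
  r u < 0 -> r x = 0 -> r y = 0 -> 0 < (x - u) * (y - u) -> x = y.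
Proof.
move=> rcvx ru.
wlog xy : x y / `|x - u| <= `|y - u|.
  move=> H rx ry s; have [/H|/ltW/H] := leP `|x - u| `|y - u|; first exact.
  by rewrite mulrC in s => /(_ ry rx s).
move=> rx ry s.
have yu : y - u != 0 by apply: contraTneq s => ->; rewrite mulr0 ltxx.
pose t := (x - u) / (y - u).
have t0 : 0 < t.
  have y2 : 0 < (y - u) ^+ 2 by rewrite exprn_even_gt0.
  by rewrite -(pmulr_lgt0 t y2) /t expr2 mulrA divfK.
have t1 : t <= 1.
  by rewrite -(gtr0_norm t0) normf_div ler_pdivrMr ?normr_gt0 // mul1r.
have ex : x = t * y + (1 - t) * u.
  by apply/eqP; rewrite -subr_eq0; apply/eqP; rewrite /t; field.
have := rcvx y u t (ltW t0) t1; rewrite -ex rx ry mulr0 add0r => le0.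
have t1' : t = 1.
  apply/eqP; rewrite eq_le t1 /= leNgt; apply/negP => tlt1.
  by move: le0; rewrite leNgt pmulr_rlt0 ?ru // subr_gt0.
by rewrite ex t1' subrr mul0r mul1r addr0.
Qed.

Lemma convex_root_opposite r u G : convex_ineq r ->
  r u < 0 -> r 0 = 0 -> r G = 0 -> G != 0 -> (0 - u) * (G - u) < 0.
Proof.
move=> rcvx ru r0 rG G0.
rewrite lt_neqAle mulf_eq0 negb_or; apply/andP; split.
  rewrite !subr_eq0.
  by apply/andP; split; apply: contraTneq ru => <-; rewrite ?r0 ?rG ltxx.
rewrite leNgt; apply/negP => s.
by have := convex_root_side rcvx ru r0 rG s => /esym/eqP; rewrite (negbTE G0).
Qed.

(** The zeros 0 and G lie on opposite sides of u, and each side of u contains at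
    most one zero. *)
Lemma convex_only_root r u G : convex_ineq r ->
  r u < 0 -> r 0 = 0 -> r G = 0 -> G != 0 -> only_root r G.
Proof.
move=> rcvx ru r0 rG G0; split => // g g0 rg.
apply: (convex_root_side rcvx ru) => //.
have := convex_root_opposite rcvx ru r0 rG G0.
have := convex_root_opposite rcvx ru r0 rg g0.
nra.
Qed.

(** Otherwise G would be a minimum of r. *)
Lemma slope_neg_value r G :
  (forall x, derivable r x 1) -> r G = 0 -> derive1 r G != 0 ->
  exists u, r u < 0.
Proof.
move=> dr rG; apply: contra_neqP => H.
rewrite derive1E.
suff dG : is_derive G 1 r 0 by rewrite derive_val.
apply: (@derive1_at_min R r (G - 1) (G + 1) G).
- by lra.
- by move=> t _; exact: dr.
- by rewrite in_itv /=; apply/andP; split; lra.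
- move=> t _; rewrite rG leNgt; apply/negP => rt; apply: H; by exists t.
Qed.

(** Around G the convex function [r p0] changes sign, from the side of u (where
    it is negative between u and G) to the other side (where it is positive).
    The three signs at u and on both sides of G are preserved for p near p0: the
    sign change produces a zero near G, and the negative value at u makes it the
    only one apart from 0. *)
Lemma convex_root_persists (T : topologicalType) (r : T -> R -> R) p0 u G :
  (forall p, convex_ineq (r p)) -> (forall p, continuous (r p)) ->
  (forall p, r p 0 = 0) ->
  (forall g, {for p0, continuous (r ^~ g)}) ->
  r p0 u < 0 -> r p0 G = 0 -> G != 0 ->
  forall e, 0 < e ->
    \forall p \near p0, exists2 g, `|g - G| < e & only_root (r p) g.
Proof.
move=> rcvx rcont r0 rp ru rG G0 e e0.
have opp := convex_root_opposite (rcvx p0) ru (r0 p0) rG G0.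
have Gu : 0 < `|G - u|.
  by rewrite normr_gt0; apply: contraTneq opp => ->; rewrite mulr0 ltxx.
(* The bound 1/2 keeps [z (- th)] strictly between u and G; the other bound
   keeps the zero to be found within e of G. *)
pose th := Num.min 2^-1 (e / 2 / `|G - u|).
have th0 : 0 < th by rewrite lt_min invr_gt0 ltr0n !divr_gt0.
have th1 : th <= 2^-1 by rewrite ge_min lexx.
have thE : th * `|G - u| < e.
  have : th * `|G - u| <= e / 2.
    by rewrite -ler_pdivlMr // ge_min lexx orbT.
  by move/le_lt_trans; apply; rewrite ltr_pdivrMr // ltr_pMr // ltr1n.
(* This parametrization of the line is oriented from u to G, so that the cases
   u < G and G < u need not be distinguished. *)
pose z s := G + s * (G - u).
have rv : r p0 (z (- th)) < 0.
  have -> : z (- th) = th * u + (1 - th) * G by rewrite /z; ring.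
  apply: le_lt_trans (rcvx p0 _ _ _ _ _) _; [lra|lra|].
  by rewrite rG mulr0 addr0 pmulr_rlt0.
have rw : 0 < r p0 (z th).
  (* The weight for which G is the combination t u + (1 - t) z th. *)
  pose t := th / (1 + th).
  have t1 : t * (1 + th) = th by rewrite /t divfK //; lra.
  have tge0 : 0 <= t by rewrite divr_ge0 //; lra.
  have tlt1 : t < 1 by rewrite ltr_pdivrMr; lra.
  have t0 : 0 < t by rewrite divr_gt0 //; lra.
  have eG : G = t * u + (1 - t) * z th.
    rewrite /z; apply/eqP; rewrite -subr_eq0.
    have -> : G - (t * u + (1 - t) * (G + th * (G - u))) =
              (G - u) * (t * (1 + th) - th) by ring.
    by rewrite t1 subrr mulr0.
  have := rcvx p0 u (z th) t (ltW t0) (ltW tlt1).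
  rewrite -eG rG => le0; rewrite ltNge; apply/negP => rz.
  move: le0; rewrite leNgt => /negP; apply.
  by apply: ltr_wnDr; [rewrite mulr_ge0_le0 //; lra|rewrite pmulr_rlt0].
near=> p.
have pu : r p u < 0.
  by near: p; apply: (cvgr_lt (r p0 u)) => //; exact: rp.
have pv : r p (z (- th)) < 0.
  by near: p; apply: (cvgr_lt (r p0 (z (- th)))) => //; exact: rp.
have pw : 0 < r p (z th).
  by near: p; apply: (cvgr_gt (r p0 (z th))) => //; exact: rp.
have [s sI rs] : exists2 s, s \in `[- th, th] & (r p \o z) s = 0.
  apply: IVT; first by lra.
    apply: continuous_subspaceT => s; apply: continuous_comp; last exact: rcont.
    by apply: cvgD; [exact: cvg_cst|exact: mulrr_continuous].
  by rewrite /= ge_min le_max (ltW pv) (ltW pw) orbT.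
move: sI; rewrite in_itv /= => /andP[s1 s2].
exists (z s).
  rewrite /z addrAC subrr add0r normrM; apply: le_lt_trans thE.
  by rewrite ler_wpM2r // ler_norml s1 s2.
apply: (convex_only_root (rcvx p) pu (r0 p) rs).
have side : 0 < (z s - u) * (G - u).
  have -> : (z s - u) * (G - u) = (1 + s) * (G - u) ^+ 2 by rewrite /z; ring.
  have Gu2 : 0 < (G - u) ^+ 2 by rewrite exprn_even_gt0 // -normr_gt0.
  by rewrite mulr_gt0 //; lra.
by apply: contraTneq side => ->; rewrite -leNgt ltW.
Unshelve. all: by end_near. Qed.

End ConvexRoots.

(** * Implicit differentiation at a point *)

Section Implicit.
Context {R : realType}.

(** Write L and c for the partial differentials of Psi with respect to p and to g,
    and E for the increment of g.  Differentiability of Psi at the single point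
    (p0, g p0) gives L v + c E = o (|v| + |E|).  As c is not 0, this first bounds
    E by a multiple of |v|, and then yields E = - L v / c + o (|v|). *)
Lemma is_diff_implicit (P : normedModType R) (Psi : P * R -> R)
    (g : P -> R) p0 :
  differentiable Psi (p0, g p0) ->
  'd Psi (p0, g p0) (0, 1) != 0 ->
  {for p0, continuous g} ->
  (\forall p \near p0, Psi (p, g p) = 0) ->
  is_diff p0 g (fun v => - ('d Psi (p0, g p0) (0, 1))^-1 *
                         'd Psi (p0, g p0) (v, 0)).
Proof.
move=> dPsi; set c := 'd Psi _ (0, 1) => c0 gc Pg.
have Psi0 := nbhs_singleton Pg.
(* H has the expected differential - L / c, which is thereby known to be linear
   and continuous. *)
pose H q := - c^-1 *: Psi (q, g p0).
have dH : is_diff p0 H (fun v => - c^-1 * 'd Psi (p0, g p0) (v, 0)).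
  have dpair : is_diff p0 (fun q => (q, g p0)) (fun v => (v, 0 : R)).
    exact: is_diff_pair (is_diff_id p0) (is_diff_cst (g p0) p0).
  exact: (is_diffZ (- c^-1) (is_diff_comp dpair (differentiableP dPsi))).
have ddH : 'd H p0 = (fun v => - c^-1 * 'd Psi (p0, g p0) (v, 0)) :> (P -> R).
  exact: diff_val.
rewrite -ddH; apply/is_diff_leP; split; first exact: diff_continuous.
move=> e e0.
have [M M0 HM] := linear_lipschitz (diff_continuous (is_diff_ex dH)).
have nc : 0 < `|c| by rewrite normr_gt0.
have M1 : 0 < 1 + M by lra.
(* The first bound absorbs half of |c| |E - 'd H p0 v| in the left-hand side, and
   the second one leaves e |c| |v| / 2. *)
pose d := Num.min (`|c| / 2) (e * `|c| / 2 / (1 + M)).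
have d0 : 0 < d by rewrite lt_min !divr_gt0 // mulr_gt0.
have dc : d <= `|c| / 2 by rewrite ge_min lexx.
have dM : d * (1 + M) <= e * `|c| / 2.
  by rewrite -ler_pdivlMr // ge_min lexx orbT.
have /is_diff_leP[_ /(_ d d0) near0] := differentiableP dPsi.
have gv0 : g (v + p0) - g p0 @[v --> (0 : P)] --> (0 : R).
  rewrite -(subrr (g p0)); apply: cvgB; last exact: cvg_cst.
  apply: (@cvg_comp _ _ _ (fun v => v + p0) g _ (nbhs p0)); last exact: gc.
  have : v + p0 @[v --> (0 : P)] --> 0 + p0.
    by apply: cvgD; [exact: cvg_id|exact: cvg_cst].
  by rewrite add0r.
have gv : (v, g (v + p0) - g p0) @[v --> (0 : P)] --> (0 : P * R).
  apply: (cvg_pair (F := nbhs (0 : P)) (G := nbhs (0 : P)) (H := nbhs (0 : R))).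
    exact: cvg_id.
  exact: gv0.
have nearE : \forall v \near (0 : P),
    `|Psi ((v, g (v + p0) - g p0) + (p0, g p0)) - Psi (p0, g p0)
      - 'd Psi (p0, g p0) (v, g (v + p0) - g p0)|
    <= d * `|(v, g (v + p0) - g p0)| := gv _ near0.
near=> v.
have Pv : Psi (v + p0, g (v + p0)) = 0.
  by near: v; move: Pg; rewrite (near_shift 0) subr0.
have : `|Psi ((v, g (v + p0) - g p0) + (p0, g p0)) - Psi (p0, g p0)
      - 'd Psi (p0, g p0) (v, g (v + p0) - g p0)|
    <= d * `|(v, g (v + p0) - g p0)| by near: v; exact: nearE.
set E := g (v + p0) - g p0.
have -> : (v, E) + (p0, g p0) = (v + p0, g (v + p0)) :> P * R.
  by congr pair; rewrite /= /E subrK.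
rewrite Pv Psi0 subrr sub0r normrN => le1.
have eL : 'd Psi (p0, g p0) (v, E) = c * (E - 'd H p0 v).
  have -> : (v, E) = (v, 0) + E *: (0, 1) :> P * R.
    by congr pair; rewrite /= ?scaler0 ?addr0 // add0r /GRing.scale /= mulr1.
  rewrite linearD linearZ /= -/c ddH.
  by rewrite /GRing.scale /= mulrBr mulNr mulrN opprK mulVKf // addrC mulrC.
have le2 : `|(v, E)| <= `|v| + `|E|.
  by rewrite prod_normE /= ge_max lerDl lerDr !normr_ge0.
have le3 : `|E| <= `|E - 'd H p0 v| + M * `|v|.
  apply: le_trans (lerD (lexx _) (HM v)).
  by rewrite -[X in `|X| <= _](subrK ('d H p0 v)) ler_normD.
rewrite -(ler_pM2l nc) -normrM -eL.
rewrite eL normrM in le1 *.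
set D := `|E - _| in le1 le3 *.
have D0 : 0 <= D by exact: normr_ge0.
have le4 := ler_wpM2r D0 dc.
have le5 := ler_wpM2r (normr_ge0 v) dM.
have le6 := ler_wpM2l (ltW d0) (le_trans le2 (lerD (lexx _) le3)).
have := le_trans le1 le6.
lra.
Unshelve. all: by end_near. Qed.
End Implicit.

(** * The relaxation parameter of one step *)

Section Relax.
Context {R : realType} {N s : nat}.
Variables (f : 'rV[R]_N -> R -> 'rV[R]_N) (eta : 'rV[R]_N -> R) (b : 'I_s -> R).
Hypothesis f_diff : forall (u : R) (x : 'rV[R]_N), differentiable (f ^~ u) x.
Hypothesis eta_smooth : smooth eta.
Hypothesis eta_convex : convex_function [set: 'rV[R]_N] eta.
Variable tau : 'I_s -> R.

Local Notation state := ('rV[R]_N * 'M[R]_(s, N))%type.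

Let psi := residual f eta b 1 tau.
Let Psi (z : state * R) := psi z.1.1 z.1.2 z.2.

(** The step size enters the residual only through the product g h, so all steps
    are reduced to the step size 1. *)
Lemma residual_scale h y Y g :
  residual f eta b h tau y Y g = psi y Y (g * h).
Proof. by rewrite /psi /residual !mulr1. Qed.

(** When the non-zero root is unique, being closest to 1 selects nothing, and the
    parameter is compatible with the change of step size.  This would fail for a
    genuine choice between roots, since scaling does not preserve the distance
    to 1. *)
Lemma relax_param_only_root h y Y G : h != 0 ->
  only_root (psi y Y) G -> relax_param f eta b h tau y Y = G / h.
Proof.
move=> h0 [G0 rG uG].
rewrite /relax_param; apply: xget_unique => [|g [g0 rg _]].
  split; first by rewrite mulf_neq0 ?invr_eq0.
    by rewrite residual_scale divfK.
  move=> g g0; rewrite residual_scale => rg.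
  by rewrite -(uG _ _ rg) ?mulf_neq0 // mulfK.
rewrite residual_scale in rg.
by rewrite -(uG _ _ rg) ?mulf_neq0 // mulfK.
Qed.

Lemma convex_ineq_line (y v : 'rV[R]_N) :
  convex_ineq (fun g => eta (y + g *: v)).
Proof.
move=> g1 g2 t t0 t1.
have := @eta_convex (Itv01 t0 t1) (y + g1 *: v) (y + g2 *: v).
rewrite !in_setT => /(_ isT isT).
rewrite convRE; apply: le_trans; rewrite le_eqVlt; apply/orP; left; apply/eqP.
congr eta; rewrite /conv /=.
apply/rowP => j; rewrite !mxE /unstable.onem; ring.
Qed.

Lemma convex_residual y Y : convex_ineq (psi y Y).
Proof.
move=> g1 g2 t t0 t1; rewrite /psi /residual !mulr1.
have := convex_ineq_line y (\sum_i b i *: stageF f tau Y i) g1 g2 t0 t1.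
lra.
Qed.

Lemma residual0 y Y : psi y Y 0 = 0.
Proof. by rewrite /psi /residual !mul0r scale0r addr0 subrr subr0. Qed.

Lemma differentiable_eta x : differentiable eta x.
Proof. by have [] := eta_smooth 1. Qed.

Lemma differentiable_grad_eta x : differentiable (grad eta) x.
Proof.
have [_ H] := eta_smooth 2.
suff : is_diff x (grad eta) (fun v =>
    \matrix_(i, j) 'd (fun x => 'D_(delta_mx i j) eta x) x v).
  by move=> E; exact: is_diff_ex.
apply: is_diff_mx => i j.
have [D _] := H j.
have -> : (fun p => grad eta p i j) = (fun x => 'D_(delta_mx i j) eta x).
  by apply/funext => p; rewrite mxE.
apply: is_diff_eq; first by apply: differentiableP; rewrite ord1; exact: D.
by apply/funext => v; rewrite mxE.
Qed.

Lemma is_diff_stageF (Y : 'M[R]_(s, N)) i :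
  is_diff Y (fun Z => stageF f tau Z i)
    (fun Z => row i Z *m stageJ f tau Y i).
Proof.
have E : is_diff (row i Y) (f ^~ (tau i)) ('d (f ^~ (tau i)) (row i Y)).
  exact: differentiableP.
apply: is_diff_eq (is_diff_comp (is_diff_row Y i) E) _.
by apply/funext => Z; rewrite /stageJ /jacobian mul_rV_lin1.
Qed.

Lemma differentiable_residual (z : state * R) :
  differentiable Psi z.
Proof.
have dy : differentiable (fun z : state * R => z.1.1) z.
  exact: is_diff_ex (is_diff_comp (is_diff_fst z) (is_diff_fst z.1)).
have dY : differentiable (fun z : state * R => z.1.2) z.
  exact: is_diff_ex (is_diff_comp (is_diff_fst z) (is_diff_snd z.1)).
have dg : differentiable (fun z : state * R => z.2) z.
  exact: is_diff_ex (is_diff_snd z).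
have dstage i : differentiable
    (fun z : state * R => stageF f tau z.1.2 i) z.
  have E := is_diff_stageF z.1.2 i.
  exact: is_diff_ex (is_diff_comp (differentiableP dY) E).
have dsum : differentiable (fun z : state * R =>
    \sum_i b i *: stageF f tau z.1.2 i) z.
  apply: is_diff_ex; apply: is_diff_sum => i _; apply: is_diffZ.
  exact: differentiableP.
have dprod : differentiable (fun z : state * R =>
    \sum_i b i * dotmx (grad eta (row i z.1.2)) (stageF f tau z.1.2 i)) z.
  apply: is_diff_ex; apply: is_diff_sum => i _.
  apply: (@is_diffZ _ _ _ (fun z : state * R =>
    dotmx (grad eta (row i z.1.2)) (stageF f tau z.1.2 i))).
  apply: differentiableP; apply: differentiable_dotmx => //.
  have E := is_diff_comp (differentiableP dY) (is_diff_row z.1.2 i).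
  exact: (differentiable_comp (is_diff_ex E) (differentiable_grad_eta _)).
have -> : Psi = (fun z : state * R =>
    eta (z.1.1 + z.2 *: \sum_i b i *: stageF f tau z.1.2 i) - eta z.1.1
    - z.2 * \sum_i b i * dotmx (grad eta (row i z.1.2)) (stageF f tau z.1.2 i)).
  by apply/funext => p; rewrite /Psi /psi /residual !mulr1.
apply: differentiableB; last first.
  by apply: is_diff_ex; apply: is_diff_mul; exact: differentiableP.
apply: differentiableB; last first.
  exact: (differentiable_comp dy (differentiable_eta _)).
apply: (@differentiable_comp _ _ _ _ (fun z : state * R =>
  z.1.1 + z.2 *: \sum_i b i *: stageF f tau z.1.2 i) eta);
  last exact: differentiable_eta.
apply: differentiableD => //.
by apply: is_diff_ex; apply: is_diff_scale; exact: differentiableP.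
Qed.

Let is_diff_Psi z : is_diff z Psi ('d Psi z).
Proof. exact: differentiableP (differentiable_residual z). Qed.

Lemma is_diff_residual_param y Y g :
  is_diff g (psi y Y) (fun k => 'd Psi (y, Y, g) (0, k)).
Proof.
have dpair : is_diff g (fun k : R => (y, Y, k)) (fun k : R => (0, k)).
  exact: is_diff_pair (is_diff_cst (y, Y) g) (is_diff_id g).
exact: (is_diff_comp dpair (is_diff_Psi (y, Y, g))).
Qed.

Lemma is_diff_residual_level y Y g :
  is_diff y (fun y' => psi y' Y g) (fun v => 'd Psi (y, Y, g) (v, 0, 0)).
Proof.
have dq : is_diff y (fun y' => (y', Y)) (fun v => (v, 0)).
  exact: is_diff_pair (is_diff_id y) (is_diff_cst Y y).
have dpair := is_diff_pair dq (is_diff_cst g y).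
exact: (is_diff_comp dpair (is_diff_Psi (y, Y, g))).
Qed.

Lemma is_diff_residual_stages y Y g :
  is_diff Y (fun Y' => psi y Y' g) (fun V => 'd Psi (y, Y, g) (0, V, 0)).
Proof.
have dq : is_diff Y (fun Y' => (y, Y')) (fun V => (0, V)).
  exact: is_diff_pair (is_diff_cst y Y) (is_diff_id Y).
have dpair := is_diff_pair dq (is_diff_cst g Y).
exact: (is_diff_comp dpair (is_diff_Psi (y, Y, g))).
Qed.

Lemma derive1_residual_scale h y Y g :
  derive1 (residual f eta b h tau y Y) g = h * derive1 (psi y Y) (g * h).
Proof.
have -> : residual f eta b h tau y Y = psi y Y \o *%R^~ h.
  by apply/funext => k; rewrite residual_scale.
rewrite derive1_comp; first last.
- by apply/derivable1_diffP; exact: is_diff_ex (is_diff_residual_param _ _ _).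
- exact/derivable1_diffP.
by rewrite derive1Mr ?derive1_id ?mul1r 1?mulrC //; exact: derivable_id.
Qed.

(** The slope in the denominator gains a factor h, and the partial gradient none. *)
Lemma relax_grad_y_scale h y Y g :
  relax_grad_y f eta b h tau y Y g =
  h^-1 *: relax_grad_y f eta b 1 tau y Y (g * h).
Proof.
have E : (fun y' => residual f eta b h tau y' Y g) =
    (fun y' => psi y' Y (g * h)).
  by apply/funext => y'; exact: residual_scale.
by rewrite /relax_grad_y E derive1_residual_scale invfM scalerA mulrN.
Qed.

Lemma relax_grad_Y_scale h y Y g :
  relax_grad_Y f eta b h tau y Y g =
  h^-1 *: relax_grad_Y f eta b 1 tau y Y (g * h).
Proof.
have E : (fun Y' => residual f eta b h tau y Y' g) =
    (fun Y' => psi y Y' (g * h)).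
  by apply/funext => Y'; exact: residual_scale.
by rewrite /relax_grad_Y E derive1_residual_scale invfM scalerA mulrN.
Qed.

Section AtRoot.
Variables (y0 : 'rV[R]_N) (Y0 : 'M[R]_(s, N)) (G0 : R).
Hypotheses (G0_neq0 : G0 != 0) (G0_root : psi y0 Y0 G0 = 0)
           (G0_slope : derive1 (psi y0 Y0) G0 != 0).

Let slope_neg : exists u, psi y0 Y0 u < 0.
Proof.
apply: (slope_neg_value _ G0_root G0_slope) => x.
by apply/derivable1_diffP; exact: is_diff_ex (is_diff_residual_param _ _ _).
Qed.

Lemma only_root_at : only_root (psi y0 Y0) G0.
Proof.
have [u ru] := slope_neg.
exact: (convex_only_root (convex_residual y0 Y0) ru (residual0 _ _)).
Qed.

Lemma only_root_near e : 0 < e -> \forall q \near (y0, Y0),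
  exists2 g, `|g - G0| < e & only_root (psi q.1 q.2) g.
Proof.
have [u ru] := slope_neg.
apply: (@convex_root_persists R _ (fun q => psi q.1 q.2) (y0, Y0) u) => //.
- by move=> q; exact: convex_residual.
- move=> q g; apply: differentiable_continuous.
  exact: is_diff_ex (is_diff_residual_param _ _ _).
- by move=> q; exact: residual0.
move=> g; apply: differentiable_continuous.
have dpair : is_diff (y0, Y0) (fun q : state => (q, g)) (fun v => (v, 0 : R)).
  exact: is_diff_pair (is_diff_id _) (is_diff_cst _ _).
exact: is_diff_ex (is_diff_comp dpair (is_diff_Psi (y0, Y0, g))).
Qed.

Let Gfun (q : state) := relax_param f eta b 1 tau q.1 q.2.

Let Gfun0 : Gfun (y0, Y0) = G0.
Proof.
by rewrite /Gfun (relax_param_only_root _ only_root_at) ?divr1 ?oner_neq0.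
Qed.

Let Gfun_cont : {for (y0, Y0), continuous Gfun}.
Proof.
apply/cvgrPdist_lt => e e0; near=> q.
rewrite Gfun0.
have [g ge gr] : exists2 g, `|g - G0| < e & only_root (psi q.1 q.2) g.
  by near: q; exact: only_root_near.
by rewrite /Gfun (relax_param_only_root _ gr) ?divr1 ?oner_neq0 // distrC.
Unshelve. all: by end_near. Qed.

Lemma is_diff_relax_param :
  is_diff (y0, Y0)
    (fun q : state => relax_param f eta b 1 tau q.1 q.2)
    (fun v => dotmx (relax_grad_y f eta b 1 tau y0 Y0 G0) v.1 +
              dotmx (relax_grad_Y f eta b 1 tau y0 Y0 G0) v.2).
Proof.
have slopeE : 'd Psi ((y0, Y0), G0) (0, 1) = derive1 (psi y0 Y0) G0.
  have E := is_diff_residual_param y0 Y0 G0.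
  by rewrite derive1E' ?diff_val //; exact: is_diff_ex E.
have /= dG := @is_diff_implicit R _ Psi Gfun (y0, Y0).
rewrite Gfun0 slopeE in dG.
apply: is_diff_eq.
  apply: dG => //; first exact: differentiable_residual.
  near=> q.
  have [g _ gr] : exists2 g, `|g - G0| < 1 & only_root (psi q.1 q.2) g.
    by near: q; exact: only_root_near.
  rewrite /Psi /Gfun /= (relax_param_only_root _ gr) ?divr1 ?oner_neq0 //.
  by case: gr.
apply/funext => -[v V] /=.
have -> : (v, V, 0) = (v, 0, 0) + (0, V, 0) :> state * R.
  by congr (_, _, _); rewrite /= ?addr0 ?add0r.
rewrite linearD /= mulrDr.
have Ey := is_diff_residual_level y0 Y0 G0.
have EY := is_diff_residual_stages y0 Y0 G0.
rewrite /relax_grad_y /relax_grad_Y !dotmxZl.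
rewrite -diff_dotmx_grad; last exact: is_diff_ex Ey.
rewrite -diff_dotmx_grad; last exact: is_diff_ex EY.
by rewrite (is_diff_diffE Ey) (is_diff_diffE EY).
Unshelve. all: by end_near. Qed.
End AtRoot.

End Relax.

(** * Blocks of the vector of all unknowns *)

Section BlockCalculus.
Context {R : realType} {N s K : nat}.
Implicit Types (p w : 'rV[R]_(Nbar N s K)).

Lemma is_diff_level p (k : 'I_K.+1) :
  is_diff p (fun q : 'rV[R]_(Nbar N s K) => level q k) (fun q => level q k).
Proof.
apply: is_diff_reindex => i j; rewrite /level.
case: (unlift ord0 k) => [k'|].
  exists 0, (rshift N (mxvec_index k' (rshift (s * N) j))) => q.
  by rewrite !mxE.
by exists i, (lshift _ j) => q; rewrite !mxE.
Qed.

Lemma is_diff_stages p (k : 'I_K) :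
  is_diff p (fun q : 'rV[R]_(Nbar N s K) => stages q k) (fun q => stages q k).
Proof.
apply: is_diff_reindex => i j; rewrite /stages.
exists 0, (rshift N (mxvec_index k (lshift N (mxvec_index i j)))) => q.
by rewrite !mxE.
Qed.

Lemma assemble_coord (j : 'I_(Nbar N s K)) :
  [\/ exists j', forall (A : 'rV[R]_N) (Y : 'I_K -> 'M[R]_(s, N)) y,
        assemble A Y y 0 j = A 0 j',
      exists k i j', forall (A : 'rV[R]_N) (Y : 'I_K -> 'M[R]_(s, N)) y,
        assemble A Y y 0 j = Y k i j'
    | exists k j', forall (A : 'rV[R]_N) (Y : 'I_K -> 'M[R]_(s, N)) y,
        assemble A Y y 0 j = y k 0 j'].
Proof.
case: (@split_ordP N (K * (s * N + N)) j) => {}j ->.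
  by apply: Or31; exists j => A Y y; rewrite row_mxEl.
case/mxvec_indexP: j => k j.
case: (split_ordP j) => {}j ->.
  case/mxvec_indexP: j => i j; apply: Or32; exists k, i, j => A Y y.
  by rewrite row_mxEr mxvecE mxE row_mxEl mxvecE.
apply: Or33; exists k, j => A Y y.
by rewrite row_mxEr mxvecE mxE row_mxEr.
Qed.

Lemma is_diff_assemble (V : normedModType R) (A dA : V -> 'rV[R]_N)
    (Y dY : V -> 'I_K -> 'M[R]_(s, N)) (y dy : V -> 'I_K -> 'rV[R]_N) x :
  is_diff x A dA ->
  (forall k, is_diff x (Y ^~ k) (dY ^~ k)) ->
  (forall k, is_diff x (y ^~ k) (dy ^~ k)) ->
  is_diff x (fun z => assemble (A z) (Y z) (y z))
            (fun v => assemble (dA v) (dY v) (dy v)).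
Proof.
move=> HA HY Hy; apply: is_diff_mx => i j; rewrite (ord1 i).
have reduce (g dg : V -> R) : is_diff x g dg ->
    (forall z, assemble (A z) (Y z) (y z) 0 j = g z) ->
    (forall v, assemble (dA v) (dY v) (dy v) 0 j = dg v) ->
    is_diff x (fun z => assemble (A z) (Y z) (y z) 0 j)
              (fun v => assemble (dA v) (dY v) (dy v) 0 j).
  by move=> H /funext -> /funext ->.
have [[j' E]|[k [i' [j' E]]]|[k [j' E]]] := assemble_coord j.
- exact: reduce (is_diff_mxE 0 j' HA) _ _.
- exact: reduce (is_diff_mxE i' j' (HY k)) _ _.
- exact: reduce (is_diff_mxE 0 j' (Hy k)) _ _.
Qed.

Lemma level0_assemble A (Y : 'I_K -> 'M[R]_(s, N)) (y : 'I_K -> 'rV[R]_N) :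
  level (assemble A Y y) ord0 = A.
Proof. by rewrite /level unlift_none /assemble row_mxKl. Qed.

Lemma block_assemble A (Y : 'I_K -> 'M[R]_(s, N)) (y : 'I_K -> 'rV[R]_N) k :
  block (assemble A Y y) k = row_mx (mxvec (Y k)) (y k).
Proof. by rewrite /block /assemble row_mxKr mxvecK rowK. Qed.

Lemma stages_assemble A (Y : 'I_K -> 'M[R]_(s, N)) (y : 'I_K -> 'rV[R]_N) k :
  stages (assemble A Y y) k = Y k.
Proof. by rewrite /stages block_assemble row_mxKl mxvecK. Qed.

Lemma level_assemble A (Y : 'I_K -> 'M[R]_(s, N)) (y : 'I_K -> 'rV[R]_N) k :
  level (assemble A Y y) (after k) = y k.
Proof. by rewrite /level /after liftK block_assemble row_mxKr. Qed.

Lemma assemble_eta w :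
  assemble (level w ord0) (stages w) (fun k => level w (after k)) = w.
Proof.
rewrite /assemble -[RHS]hsubmxK; congr row_mx.
  by rewrite /level unlift_none.
rewrite -[RHS]vec_mxK; congr mxvec; apply/row_matrixP => k.
rewrite rowK -[RHS]hsubmxK /level /after liftK; congr row_mx.
by rewrite /stages vec_mxK.
Qed.

Lemma assemble_eqP A (Y : 'I_K -> 'M[R]_(s, N)) (y : 'I_K -> 'rV[R]_N) w :
  assemble A Y y = w <->
  [/\ A = level w ord0, forall k, Y k = stages w k
    & forall k, y k = level w (after k)].
Proof.
split=> [<-|[-> HY Hy]].
  by rewrite level0_assemble; split => // k;
     rewrite ?stages_assemble ?level_assemble.
rewrite -[RHS]assemble_eta; congr assemble; exact/funext.
Qed.

End BlockCalculus.

(** Passes from a block of the residual form of the equations to the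
    time-stepping form. *)
Lemma sub_sub_eq (V : zmodType) (x y A B w : V) :
  x - y - (A + B) = w <-> x = y + A + B + w.
Proof.
have -> : x - y - (A + B) = x - (y + A + B) by rewrite -addrA -opprD addrA.
by split=> [<-|->]; [rewrite subrKC|rewrite addrC addKr].
Qed.

(** * The differential of the reduced operator *)

Section Linearization.
Context {R : realType} {N s K : nat}.
Variables (f : 'rV[R]_N -> R -> 'rV[R]_N) (eta : 'rV[R]_N -> R).
Variables (a : 'M[R]_s) (b c : 'I_s -> R) (dt T : R) (yinit : 'rV[R]_N).
Variables (ybar : 'rV[R]_(Nbar N s K)) (t : 'I_K.+1 -> R) (gamma : 'I_K -> R).
Hypothesis dt_gt0 : 0 < dt.
Hypothesis f_diff : forall (u : R) (x : 'rV[R]_N), differentiable (f ^~ u) x.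
Hypothesis eta_smooth : smooth eta.
Hypothesis eta_convex : convex_function [set: 'rV[R]_N] eta.
Hypothesis ybar_rrk : rrk_solution f eta a b c dt T yinit ybar t gamma.

Let tau := stage_time c dt T t.
Let y k := level ybar (before k).
Let Y := stages ybar.
Let F k := stageF f (tau k) (Y k).
Let J k := stageJ f (tau k) (Y k).
Let h := step_size dt T t.
Let psi k := residual f eta b 1 (tau k).
(* The product of relaxation parameter and step size in step k, as a function of
   all unknowns. *)
Let G k p := relax_param f eta b 1 (tau k) (level p (before k)) (stages p k).

(** The quantity written rho_k in the time-stepping formulas: the variation of the
    relaxation parameter at a fixed step size. *)
Definition gamma_variation (delta : 'rV[R]_(Nbar N s K)) k :=
  dotmx (relax_grad_y f eta b (h k) (tau k) (y k) (Y k) (gamma k))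
        (level delta (before k))
  + dotmx (relax_grad_Y f eta b (h k) (tau k) (y k) (Y k) (gamma k))
          (stages delta k).

Let step_gt0 k : 0 < h k.
Proof. by have [_ _ /(_ k)[]] := ybar_rrk. Qed.

Let step_neq0 k : h k != 0.
Proof. by rewrite gt_eqF. Qed.

Let root_facts k : [/\ gamma k * h k != 0, psi k (y k) (Y k) (gamma k * h k) = 0
  & derive1 (psi k (y k) (Y k)) (gamma k * h k) != 0].
Proof.
have [_ _ /(_ k)[_ _ _ _ [[g0 rg _]]]] := ybar_rrk.
rewrite derive1_residual_scale // mulf_eq0 negb_or => /andP[_ slope].
by split => //; [rewrite mulf_neq0|rewrite -rg residual_scale].
Qed.

Let only_root_ybar k : only_root (psi k (y k) (Y k)) (gamma k * h k).
Proof. by have [g0 rg slope] := root_facts k; exact: only_root_at. Qed.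

Let is_diff_inputs k :
  is_diff ybar (fun p : 'rV[R]_(Nbar N s K) => (level p (before k), stages p k))
               (fun p => (level p (before k), stages p k)).
Proof. exact: is_diff_pair (is_diff_level _ _) (is_diff_stages _ _). Qed.

(* One neighbourhood serves all step sizes h', which matters in the last step,
   where the step size itself varies with p. *)
Let relax_param_near :
  \forall p \near ybar, forall k h', h' != 0 ->
    relax_param f eta b h' (tau k) (level p (before k)) (stages p k)
    = G k p / h'.
Proof.
have near_k (k : 'I_K) : \forall p \near ybar, forall h', h' != 0 ->
    relax_param f eta b h' (tau k) (level p (before k)) (stages p k)
    = G k p / h'; last exact: (@filter_forall _ _ _ (nbhs ybar) _ near_k).
have [g0 rg slope] := root_facts k.
have H := only_root_near f_diff eta_smooth eta_convex g0 rg slope ltr01.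
have Q : \forall p \near ybar, exists2 g, `|g - gamma k * h k| < 1
    & only_root (psi k (level p (before k)) (stages p k)) g.
  exact: (differentiable_continuous (is_diff_ex (is_diff_inputs k)) H).
apply: filterS Q => p [g _ gr] h' h'0.
rewrite /G (relax_param_only_root h'0 gr).
by rewrite (relax_param_only_root (oner_neq0 R) gr) divr1.
Qed.

Let G_ybar k : G k ybar = gamma k * h k.
Proof.
by rewrite /G (relax_param_only_root (oner_neq0 R) (only_root_ybar k)) divr1.
Qed.

Let is_diff_G k :
  is_diff ybar (G k) (fun delta => gamma_variation delta k * h k).
Proof.
have [g0 rg slope] := root_facts k.
have H := is_diff_relax_param f_diff eta_smooth eta_convex g0 rg slope.
apply: is_diff_eq (is_diff_comp (is_diff_inputs k) H) _.
apply/funext => delta; rewrite /gamma_variation.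
rewrite [relax_grad_y _ _ _ (h k) _ _ _ _]relax_grad_y_scale //.
rewrite [relax_grad_Y _ _ _ (h k) _ _ _ _]relax_grad_Y_scale //.
by rewrite !(dotmxZl (h k)^-1) -mulrDr mulrAC mulVf ?step_neq0 // mul1r.
Qed.

Let level_time (k : 'I_K) :
  t (before k) = dt * \sum_(l < K | (l < k)%N) gamma l.
Proof.
have [t0 _ sol] := ybar_rrk.
case: k => m; elim: m => [|m IH] mK.
  by rewrite big_pred0 // mulr0 -t0; congr t; exact: val_inj.
have m'K : (m < K)%N by exact: ltnW.
have -> : before (Ordinal mK) = after (Ordinal m'K) by exact: val_inj.
have [-> _ _ _ _] := sol (Ordinal m'K).
rewrite ltn_eqF // IH [in RHS](bigD1 (Ordinal m'K)) //=.
rewrite mulrDr addrC [dt * gamma _]mulrC.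
congr (_ + _ * _); apply: eq_bigl => l.
by rewrite ltnS ltn_neqAle andbC.
Qed.

Let inner_step (l : 'I_K) : (l.+1 < K)%N -> h l = dt.
Proof. by move=> lK; rewrite /h /step_size ltn_eqF. Qed.

Let last_step_ybar : last_step_size f eta b dt T tau ybar =
  T - dt * \sum_(l < K | (l.+1 < K)%N) gamma l.
Proof.
congr (_ - _ * _); apply: eq_bigr => l lK.
rewrite (relax_param_only_root (lt0r_neq0 dt_gt0) (only_root_ybar l)).
by rewrite inner_step // mulfK ?gt_eqF.
Qed.

Let is_diff_last_step :
  is_diff ybar (last_step_size f eta b dt T tau)
    (fun delta => - (\sum_(l < K | (l.+1 < K)%N) gamma_variation delta l * dt)).
Proof.
have H : is_diff ybar (fun p => T - \sum_(l < K | (l.+1 < K)%N) G l p)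
    (fun delta =>
       0 - \sum_(l < K | (l.+1 < K)%N) gamma_variation delta l * h l).
  apply: is_diffB; apply: is_diff_sum => l _; exact: is_diff_G.
apply: is_diff_eq.
  apply: is_diff_near H _; near=> p.
  rewrite /last_step_size mulr_sumr; congr (_ - _); apply: eq_bigr => l _.
  have -> := near relax_param_near p _ l _ (lt0r_neq0 dt_gt0) => //.
  by rewrite mulrC divfK ?gt_eqF.
apply/funext => delta; rewrite sub0r; congr (- _).
by apply: eq_bigr => l lK; rewrite inner_step.
Unshelve. all: by end_near. Qed.

(** Only the last step size varies; it does so with minus dt times the sum written
    rho_star in the time-stepping formulas. *)
Definition step_variation (delta : 'rV[R]_(Nbar N s K)) (k : 'I_K) : R :=
  if k.+1 == K then - (\sum_(l < K | (l.+1 < K)%N) gamma_variation delta l * dt)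
  else 0.

Let step_ybar k : reduced_step_size f eta b dt T tau ybar k = h k.
Proof.
rewrite /reduced_step_size /h /step_size; case: eqP => // kK.
rewrite last_step_ybar level_time; congr (_ - _ * _); apply: eq_bigl => l.
by rewrite -[RHS]ltnS; congr (_ < _)%N.
Qed.

Let is_diff_step k :
  is_diff ybar (reduced_step_size f eta b dt T tau ^~ k) (step_variation ^~ k).
Proof.
rewrite /reduced_step_size /step_variation; case: eqP => _.
  exact: is_diff_last_step.
exact: is_diff_cst.
Qed.

(* The step size cancels near [ybar], so the variation of the last step size
   does not contribute. *)
Let is_diff_gammah k :
  is_diff ybar (fun p => reduced_gamma f eta b dt T tau p k *
                         reduced_step_size f eta b dt T tau p k)
    (fun delta => gamma_variation delta k * h k).
Proof.
apply: is_diff_near (is_diff_G k) _.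
have pos : \forall p \near ybar, 0 < reduced_step_size f eta b dt T tau p k.
  have := differentiable_continuous (is_diff_ex (is_diff_step k)).
  move=> /cvgr_gt; rewrite step_ybar; exact.
near=> p.
have p0 : reduced_step_size f eta b dt T tau p k != 0.
  by rewrite gt_eqF //; near: p.
rewrite /reduced_gamma.
have -> := near relax_param_near p _ k _ p0 => //.
by rewrite divfK.
Unshelve. all: by end_near. Qed.

Lemma is_diff_reduced_op :
  is_diff ybar (reduced_op f eta a b dt T yinit tau) (fun delta =>
    assemble (level delta ord0)
      (fun k => \matrix_(i < s) (row i (stages delta k) - level delta (before k)
         - (h k *: (\sum_j a i j *: (row j (stages delta k) *m J k j))
            + step_variation delta k *: \sum_j a i j *: F k j)))
      (fun k => level delta (after k) - level delta (before k)
         - ((gamma k * h k) *: (\sum_i b i *: (row i (stages delta k) *m J k i))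
            + (gamma_variation delta k * h k) *: \sum_i b i *: F k i))).
Proof.
have dF k j : is_diff ybar (fun p => stageF f (tau k) (stages p k) j)
    (fun delta => row j (stages delta k) *m J k j).
  have E := is_diff_stageF f_diff (tau k) (stages ybar k) j.
  exact: (is_diff_comp (is_diff_stages ybar k) E).
have dFsum k (w : 'I_s -> R) :
    is_diff ybar (fun p => \sum_j w j *: stageF f (tau k) (stages p k) j)
    (fun delta => \sum_j w j *: (row j (stages delta k) *m J k j)).
  by apply: is_diff_sum => j _; exact: (is_diffZ (w j) (dF k j)).
rewrite /reduced_op; apply: is_diff_assemble => [|k|k].
- apply: is_diff_eq.
    exact: is_diffB (is_diff_level _ _) (is_diff_cst _ _).
  by apply/funext => delta; rewrite !fctE subr0.
- apply: is_diff_rows => i.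
  apply: is_diffB; last first.
    rewrite -step_ybar; exact: is_diff_scale (is_diff_step k) (dFsum k (a i)).
  apply: is_diffB; last exact: is_diff_level.
  exact: (is_diff_comp (is_diff_stages ybar k) (is_diff_row _ i)).
apply: is_diffB; first by apply: is_diffB; exact: is_diff_level.
have E : gamma k * h k = reduced_gamma f eta b dt T tau ybar k *
                         reduced_step_size f eta b dt T tau ybar k.
  have := nbhs_singleton relax_param_near k _ (step_neq0 k).
  by rewrite -/Y /reduced_gamma step_ybar => ->; rewrite G_ybar mulfK.
rewrite E; exact: is_diff_scale (is_diff_gammah k) (dFsum k b).
Qed.

End Linearization.

Theorem lemma3 (R : realType) (N s K : nat)
  (f : 'rV[R]_N -> R -> 'rV[R]_N) (eta : 'rV[R]_N -> R)
  (a : 'M[R]_s) (b c : 'I_s -> R) (dt T : R) (yinit : 'rV[R]_N)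
  (ybar : 'rV[R]_(Nbar N s K)) (t : 'I_K.+1 -> R) (gamma : 'I_K -> R)
  (K_gt0 : (0 < K)%N) (dt_gt0 : 0 < dt) (T_gt0 : 0 < T)
  (f_diff : forall (u : R) (x : 'rV[R]_N), differentiable (f ^~ u) x)
  (eta_smooth : smooth eta)
  (eta_convex : convex_function [set: 'rV[R]_N] eta)
  (ybar_rrk : rrk_solution f eta a b c dt T yinit ybar t gamma) :
  let tau := stage_time c dt T t in
  let E := reduced_op f eta a b dt T yinit tau in
  let y k := level ybar (before k) in
  let Y := stages ybar in
  let F k := stageF f (tau k) (Y k) in
  let J k := stageJ f (tau k) (Y k) in
  let h := step_size dt T t in
  differentiable E ybar /\
  forall w delta : 'rV[R]_(Nbar N s K),
    let rho k :=
      dotmx (relax_grad_y f eta b (h k) (tau k) (y k) (Y k) (gamma k))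
            (level delta (before k))
      + dotmx (relax_grad_Y f eta b (h k) (tau k) (y k) (Y k) (gamma k))
              (stages delta k) in
    let rho_star := \sum_(k < K | (k.+1 < K)%N) rho k in
    delta *m 'J E ybar = w <->
    [/\ level delta ord0 = level w ord0,
        forall k : 'I_K, (k.+1 < K)%N ->
          (forall i, row i (stages delta k) =
             level delta (before k)
             + dt *: \sum_j a i j *: (row j (stages delta k) *m J k j)
             + row i (stages w k)) /\
          level delta (after k) =
            level delta (before k)
            + (gamma k * dt) *: \sum_i b i *: (row i (stages delta k) *m J k i)
            + (rho k * dt) *: \sum_i b i *: F k i
            + level w (after k)
      & forall k : 'I_K, k.+1 = K ->
          let dt_star := T - t (before k) in
          (forall i, row i (stages delta k) =
             level delta (before k)
             + dt_star *: \sum_j a i j *: (row j (stages delta k) *m J k j)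
             - (rho_star * dt) *: \sum_j a i j *: F k j
             + row i (stages w k)) /\
          level delta (after k) =
            level delta (before k)
            + (gamma k * dt_star) *:
                \sum_i b i *: (row i (stages delta k) *m J k i)
            + (rho k * dt_star) *: \sum_i b i *: F k i
            + level w (after k)].
Proof.
have dE := is_diff_reduced_op dt_gt0 f_diff eta_smooth eta_convex ybar_rrk.
split; first exact: is_diff_ex dE.
move=> w delta rho rho_star.
rewrite /jacobian mul_rV_lin1 (is_diff_diffE dE) assemble_eqP.
have rows_eq k (r : 'I_s -> 'rV[R]_N) :
    \matrix_(i < s) r i = stages w k <-> forall i, r i = row i (stages w k).
  split=> [<- i|H]; first by rewrite rowK.
  by apply/row_matrixP => i; rewrite rowK.
have inner (k : 'I_K) : (k.+1 < K)%N ->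
    step_size dt T t k = dt /\
    step_variation f eta b c dt T ybar t gamma delta k = 0.
  by move=> kK; rewrite /step_size /step_variation ltn_eqF.
have last (k : 'I_K) : k.+1 = K -> step_size dt T t k = T - t (before k) /\
    step_variation f eta b c dt T ybar t gamma delta k = - (rho_star * dt).
  by move=> kK; rewrite /step_size /step_variation kK eqxx -mulr_suml.
split=> [[H0 HY Hy]|[H0 Hin Hlast]].
  split=> // k kK.
    have [hk dk] := inner k kK; split=> [i|].
      have /rows_eq/(_ i)/sub_sub_eq := HY k.
      by rewrite hk dk scale0r addr0.
    by have /sub_sub_eq := Hy k; rewrite hk.
  have [hk dk] := last k kK; split=> [i|].
    have /rows_eq/(_ i)/sub_sub_eq := HY k.
    by rewrite hk dk scaleNr.
  by have /sub_sub_eq := Hy k; rewrite hk.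
split=> // k.
  apply/rows_eq => i; apply/sub_sub_eq.
  have [kK|Kk] := ltnP k.+1 K.
    have [hk dk] := inner k kK; have [/(_ i) Hi _] := Hin k kK.
    by rewrite hk dk scale0r addr0.
  have kK : k.+1 = K by apply/eqP; rewrite eqn_leq Kk ltn_ord.
  have [hk dk] := last k kK; have [/(_ i) Hi _] := Hlast k kK.
  by rewrite hk dk scaleNr.
apply/sub_sub_eq.
have [kK|Kk] := ltnP k.+1 K.
  have [hk _] := inner k kK; have [_ Hk] := Hin k kK.
  by rewrite hk.
have kK : k.+1 = K by apply/eqP; rewrite eqn_leq Kk ltn_ord.
have [hk _] := last k kK; have [_ Hk] := Hlast k kK.
by rewrite hk.
Qed.
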